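(* Let $\mathfrak{N}$ be the inverse surface of the tangent developable surface $\mathfrak{M}(s,u)=\gamma(s)+uT(s)$ with respect to the inversion $\Phi=\Phi[c,r]$. Then $\mathfrak{N}$ is a flat surface if and only if either the normal lines to the surface $\mathfrak{M}$ pass through the center $c$ of inversion or the tangent planes of the surface $\mathfrak{M}$ pass through the center $c$ of inversion.
   Context: Let $c\in\mathbb{E}^3$ (Euclidean 3-space) and $r>0$. The inversion with center $c$ and radius $r$ (i.e. with respect to the sphere $S_c(r)$) is the map $\Phi[c,r]:\mathbb{E}^3\setminus\{c\}\to\mathbb{E}^3\setminus\{c\}$, $\Phi[c,r](p)=c+\frac{r^2}{\|p-c\|^2}(p-c)$. Let $\gamma:I\subset\mathbb{R}\to\mathbb{E}^3$ be a smooth curve parametrized by arc length $s$, with Frenet frame $\{T,N,B\}$, curvature $\kappa$ and torsion $\tau$, so that $T'=\kappa N$, $N'=-\kappa T+\tau B$, $B'=-\tau N$. The tangent developable of $\gamma$ is the ruled surface $\mathfrak{M}(s,u)=\gamma(s)+uT(s)$. It is considered where $u\kappa(s)\neq0$ and $\mathfrak{M}(s,u)\neq c$. Its unit normal is $U_{\mathfrak{M}}=-\operatorname{sgn}(u\kappa)B(s)$. The inverse surface of $\mathfrak{M}$ is $\mathfrak{N}=\Phi[c,r]\circ\mathfrak{M}=c+\frac{r^2}{\|\mathfrak{M}-c\|^2}(\mathfrak{M}-c)$, with parameters $(s,u)$. A surface is flat if its Gauss curvature vanishes identically. The normal line (resp. tangent plane) of $\mathfrak{M}$ at a point is the line through that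 point in the direction $U_{\mathfrak{M}}$ (resp. the affine plane through that point orthogonal to $U_{\mathfrak{M}}$); ''the normal lines (tangent planes) pass through $c$'' means that this holds at the points of the surface. *)

(* Defs.v *)
From mathcomp Require Import all_boot all_order all_algebra.
From mathcomp Require Import all_classical all_reals all_analysis.
From mathcomp Require Import ring lra.
Set Implicit Arguments.
Unset Strict Implicit.
Unset Printing Implicit Defensive.
Import Order.TTheory GRing.Theory Num.Theory.
Import numFieldNormedType.Exports.
Local Open Scope ring_scope.
Local Open Scope classical_set_scope.

Definition dot (R : realType) (u v : 'rV[R]_3) : R := (u *m v^T) 0 0.

(* The library norm `|v| on row vectors is the sup norm; E^3 needs this one. *)
Definition enorm (R : realType) (v : 'rV[R]_3) : R := Num.sqrt (dot v v).

(* The indices k + 1 and k + 2 are taken modulo 3. *)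
Definition cross (R : realType) (u v : 'rV[R]_3) : 'rV[R]_3 :=
  \row_(k < 3) (u 0 (k + 1) * v 0 (k + 2%:R) - u 0 (k + 2%:R) * v 0 (k + 1)).

(* Total version: the inversion proper is its restriction to p != c. *)
Definition inversion (R : realType) (c : 'rV[R]_3) (r : R) (p : 'rV[R]_3) :
    'rV[R]_3 :=
  c + (r ^+ 2 / enorm (p - c) ^+ 2) *: (p - c).

(* On an open set I the iterated two-sided derivatives are those of the
   restriction to I; the values outside I are irrelevant. *)
Definition smooth_on (R : realType) (I : set R) (f : R -> 'rV[R]_3) : Prop :=
  forall (n : nat) (s : R), I s -> derivable (f^`(n)) s 1.

Definition arc_length_param (R : realType) (I : set R) (gamma : R -> 'rV[R]_3) :
    Prop :=
  forall s, I s -> enorm (derive1 gamma s) = 1.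

(* No sign is imposed on kappa, so that both the convention kappa = |gamma''|
   and signed curvatures are covered; kappa may vanish, provided that the frame
   extends differentiably across its zeros. *)
Record frenet_apparatus (R : realType) (I : set R)
    (gamma T N B : R -> 'rV[R]_3) (kappa tau : R -> R) : Prop :=
  FrenetApparatus {
    frenet_tangent : forall s, I s -> T s = derive1 gamma s;
    frenet_unitT : forall s, I s -> enorm (T s) = 1;
    frenet_unitN : forall s, I s -> enorm (N s) = 1;
    frenet_orthTN : forall s, I s -> dot (T s) (N s) = 0;
    frenet_binormal : forall s, I s -> B s = cross (T s) (N s);
    frenet_T' : forall s, I s -> is_derive s 1 T (kappa s *: N s);
    frenet_N' : forall s, I s ->
      is_derive s 1 N (- kappa s *: T s + tau s *: B s);
    frenet_B' : forall s, I s -> is_derive s 1 B (- tau s *: N s) }.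

Definition pderiv1 (R : realType) (X : R -> R -> 'rV[R]_3) (s u : R) :
    'rV[R]_3 :=
  derive1 (X^~ u) s.

Definition pderiv2 (R : realType) (X : R -> R -> 'rV[R]_3) (s u : R) :
    'rV[R]_3 :=
  derive1 (X s) u.

Definition unit_normal (R : realType) (X : R -> R -> 'rV[R]_3) (s u : R) :
    'rV[R]_3 :=
  let n := cross (pderiv1 X s u) (pderiv2 X s u) in (enorm n)^-1 *: n.

Definition normal_line (R : realType) (X : R -> R -> 'rV[R]_3) (s u : R) :
    set 'rV[R]_3 :=
  [set p | exists t : R, p = X s u + t *: unit_normal X s u].

Definition tangent_plane (R : realType) (X : R -> R -> 'rV[R]_3) (s u : R) :
    set 'rV[R]_3 :=
  [set p | dot (p - X s u) (unit_normal X s u) = 0].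

Definition gauss_curvature (R : realType) (X : R -> R -> 'rV[R]_3) (s u : R) : R :=
  let Xs := pderiv1 X s u in
  let Xu := pderiv2 X s u in
  let n := unit_normal X s u in
  let E := dot Xs Xs in
  let F := dot Xs Xu in
  let G := dot Xu Xu in
  let L := dot (pderiv1 (pderiv1 X) s u) n in
  let M := dot (pderiv2 (pderiv1 X) s u) n in
  let N := dot (pderiv2 (pderiv2 X) s u) n in
  (L * N - M ^+ 2) / (E * G - F ^+ 2).

Definition flat_on (R : realType) (D : set (R * R)) (X : R -> R -> 'rV[R]_3) :
    Prop :=
  forall s u, D (s, u) -> gauss_curvature X s u = 0.

Definition tangent_developable (R : realType) (gamma T : R -> 'rV[R]_3)
    (s u : R) : 'rV[R]_3 :=
  gamma s + u *: T s.

Definition inverse_surface (R : realType) (c : 'rV[R]_3) (r : R)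
    (X : R -> R -> 'rV[R]_3) (s u : R) : 'rV[R]_3 :=
  inversion c r (X s u).

Definition developable_domain (R : realType) (I : set R) (c : 'rV[R]_3)
    (gamma T : R -> 'rV[R]_3) (kappa : R -> R) : set (R * R) :=
  [set su | [/\ I su.1, su.2 * kappa su.1 != 0 &
    tangent_developable gamma T su.1 su.2 != c]].

Lemma dotE (R : realType) (u v : 'rV[R]_3) :
  dot u v = u 0 0 * v 0 0 + u 0 1 * v 0 1 + u 0 2%:R * v 0 2%:R.
Proof.
rewrite /dot !mxE !big_ord_recl big_ord0 !mxE /= addr0 addrA.
by do !congr (_ + _); congr (_ * _); congr (_ _ _); apply/val_inj.
Qed.

Lemma crossE (R : realType) (u v : 'rV[R]_3) :
 [/\ cross u v 0 0 = u 0 1 * v 0 2%:R - u 0 2%:R * v 0 1,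
  cross u v 0 1 = u 0 2%:R * v 0 0 - u 0 0 * v 0 2%:R &
  cross u v 0 2%:R = u 0 0 * v 0 1 - u 0 1 * v 0 0].
Proof.
split; rewrite mxE; congr (_ * _ - _ * _); congr (_ _ _); exact/val_inj.
Qed.

(* U = - sgn(u kappa) B, with U computed from M_s x M_u. *)
Lemma unit_normal_tangent_developable (R : realType) (I : set R)
    (gamma T N B : R -> 'rV[R]_3) (kappa tau : R -> R) (s u : R) :
  smooth_on I gamma -> frenet_apparatus I gamma T N B kappa tau ->
  I s -> u * kappa s != 0 ->
  unit_normal (tangent_developable gamma T) s u = - Num.sg (u * kappa s) *: B s.
Proof.
move=> gs fr Is nz.
have dT := frenet_T' fr Is.
have hs : pderiv1 (tangent_developable gamma T) s u = T s + (u * kappa s) *: N s.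
  rewrite /pderiv1 derive1E.
  have dg : is_derive s 1 gamma (T s).
    rewrite (frenet_tangent fr Is) derive1E; apply: DeriveDef => //; exact: (gs 0%N).
  rewrite /tangent_developable -scalerA.
  have := @is_deriveD _ _ _ gamma (u \*: T) s 1 _ _ dg (is_deriveZ _ dT).
  by move=> h; rewrite -[RHS](@derive_val _ _ _ _ _ _ _ h).
have hu : pderiv2 (tangent_developable gamma T) s u = T s.
  rewrite /pderiv2 derive1E /tangent_developable.
  apply/rowP => i.
  have h : is_derive u 1 (fun t : R => gamma s + t *: T s) (T s).
    have h1 : is_derive u 1 (fun t : R => t *: T s) (T s).
      apply: DeriveDef.
        apply/derivable_mxP => a b.
        rewrite (_ : (fun _ => _) = (fun t : R => t * T s a b)); last by apply/funext => t; rewrite !mxE.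
        exact: derivableM.
      apply/matrixP => a b; rewrite derive_mx ?mxE.
        rewrite (_ : (fun _ => _) = (id : R -> R) * cst (T s a b)); last by apply/funext => t; rewrite !mxE.
        by rewrite deriveM// derive_cst derive_id scaler0 add0r /GRing.scale /= mulr1.
      apply/derivable_mxP => a' b'.
      rewrite (_ : (fun _ => _) = (fun t : R => t * T s a' b')); last by apply/funext => t; rewrite !mxE.
      exact: derivableM.
    have := @is_deriveD _ _ _ (cst (gamma s)) _ u 1 _ _ (is_derive_cst _ _ _) h1.
    by rewrite add0r.
  by rewrite (@derive_val _ _ _ _ _ _ _ h).
have nB : dot (B s) (B s) = 1.
  have := frenet_unitT fr Is; have := frenet_unitN fr Is; have := frenet_orthTN fr Is.
  rewrite (frenet_binormal fr Is) /enorm => o /(congr1 (fun x => x ^+ 2)) + /(congr1 (fun x => x ^+ 2)).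
  have ge0 (v : 'rV[R]_3) : 0 <= dot v v by rewrite dotE; nra.
  rewrite !sqr_sqrtr // expr1n => n t.
  have [c0 c1 c2] := crossE (T s) (N s).
  have -> : dot (cross (T s) (N s)) (cross (T s) (N s)) = dot (T s) (T s) * dot (N s) (N s) - dot (T s) (N s) ^+ 2.
    by rewrite !dotE c0 c1 c2; ring.
  by rewrite o n t expr0n subr0 mulr1.
have hc : cross (T s + (u * kappa s) *: N s) (T s) = - (u * kappa s) *: B s.
  rewrite (frenet_binormal fr Is); apply/rowP => i; rewrite !mxE; ring.
rewrite /unit_normal hs hu hc /enorm.
have -> : dot (- (u * kappa s) *: B s) (- (u * kappa s) *: B s) = (u * kappa s)^+2 .
  transitivity ((u * kappa s)^+2 * dot (B s) (B s)); last by rewrite nB mulr1.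
  rewrite !dotE !mxE; ring.
rewrite sqrtr_sqr scalerA; congr (_ *: _).
rewrite mulrN; congr (- _).
by rewrite {2}[u * kappa s]numEsg mulrCA mulVf ?mulr1 // normr_eq0.
Qed.

(* Main.v *)
Require Import Defs.
From mathcomp Require Import all_boot all_order all_algebra.
From mathcomp Require Import all_classical all_reals all_analysis.
From mathcomp Require Import ring lra.
Import Order.TTheory GRing.Theory Num.Theory.
Import numFieldNormedType.Exports.
Local Open Scope ring_scope.
Local Open Scope classical_set_scope.
Set Implicit Arguments.
Unset Strict Implicit.
Unset Printing Implicit Defensive.

(** Why the theorem holds.  Write [x = M - c].  The differential of the
inversion at [x] is [r^2 / |x|^2] times the reflection in the plane orthogonal
to [x], so inversion is conformal, and differentiating once more shows how it
changes the second fundamental form: up to a common factor and the sign of the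
normal, [II] becomes [II + 2 (<x,n> / |x|^2) I].  This gives the Gauss
curvature of the inverse of an arbitrary surface in terms of its two
fundamental forms ([gauss_curvature_inverse_surface]).

For the tangent developable, the only entry of [II] that may be nonzero comes
from the torsion, and the formula collapses
([gauss_curvature_inverse_developable]) to
  [2 d (|x|^2 tau + 2 d u kappa) / (r^4 u kappa)],  where [d = <x,B>].
The tangent plane at a point passes through [c] exactly when [d = 0] there, and
then the curvature vanishes.

Conversely, [d] depends only on [s], because [<T,B> = 0].  If [d] were nonzero
at some [s] with [kappa s != 0], flatness would force
[|x|^2 tau + 2 d u kappa = 0] for every nonzero [u].  Adding the equations for
[u = 1] and [u = -1] kills the terms odd in [u] and leaves
[(1 + |gamma - c|^2) tau = 0], so [tau = 0], hence [d kappa = 0], a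
contradiction ([flat_inverse_binormal]).

Finally, the alternative on normal lines is degenerate: on a ruling, the only
point whose normal line can contain [c] is the foot of the perpendicular
dropped from [c] ([normal_line_developable_inj]).  Every ruling with
[kappa s != 0] has more than one point, so this alternative holds only if the
surface is empty, and then the inverse surface is vacuously flat. *)

(** * Dot products, cross products and reflections *)

Section Euclidean.
Variable R : realType.
Implicit Types (u v w x : 'rV[R]_3) (a : R).

Lemma row3P u v :
  u 0 0 = v 0 0 -> u 0 1 = v 0 1 -> u 0 2%:R = v 0 2%:R -> u = v.
Proof.
move=> e0 e1 e2; apply/rowP; case=> [[|[|[|//]]]] lt_i3.
- by rewrite (_ : Ordinal lt_i3 = 0) //; exact/val_inj.
- by rewrite (_ : Ordinal lt_i3 = 1) //; exact/val_inj.
- by rewrite (_ : Ordinal lt_i3 = 2%:R) //; exact/val_inj.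
Qed.

Lemma dotC u v : dot u v = dot v u.
Proof. by rewrite !dotE; ring. Qed.

Lemma dotDl u v w : dot (u + v) w = dot u w + dot v w.
Proof. by rewrite !dotE !mxE; ring. Qed.

Lemma dotBl u v w : dot (u - v) w = dot u w - dot v w.
Proof. by rewrite !dotE !mxE; ring. Qed.

Lemma dotZl a u v : dot (a *: u) v = a * dot u v.
Proof. by rewrite !dotE !mxE; ring. Qed.

Lemma dotDr u v w : dot w (u + v) = dot w u + dot w v.
Proof. by rewrite !dotE !mxE; ring. Qed.

Lemma dotBr u v w : dot w (u - v) = dot w u - dot w v.
Proof. by rewrite !dotE !mxE; ring. Qed.

Lemma dotNl u v : dot (- u) v = - dot u v.
Proof. by rewrite !dotE !mxE; ring. Qed.

Lemma dotNr u v : dot u (- v) = - dot u v.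
Proof. by rewrite !dotE !mxE; ring. Qed.

Lemma dotZr a u v : dot u (a *: v) = a * dot u v.
Proof. by rewrite !dotE !mxE; ring. Qed.

Lemma dot_ge0 v : 0 <= dot v v.
Proof. by rewrite dotE; nra. Qed.

Lemma dot_eq0 v : (dot v v == 0) = (v == 0).
Proof.
apply/eqP/eqP => [|->]; last by rewrite dotE !mxE; ring.
by rewrite dotE => vv0; apply: row3P; rewrite mxE; nra.
Qed.

Lemma enorm_sqr v : enorm v ^+ 2 = dot v v.
Proof. by rewrite sqr_sqrtr ?dot_ge0. Qed.

Lemma enorm1_dot v : enorm v = 1 -> dot v v = 1.
Proof. by rewrite -enorm_sqr => ->; rewrite expr1n. Qed.

Lemma cross_dotl u v : dot u (cross u v) = 0.
Proof. by have [c0 c1 c2] := crossE u v; rewrite dotE c0 c1 c2; ring. Qed.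

Lemma cross_dotr u v : dot v (cross u v) = 0.
Proof. by have [c0 c1 c2] := crossE u v; rewrite dotE c0 c1 c2; ring. Qed.

Lemma crossZ a u v : cross (a *: u) (a *: v) = a ^+ 2 *: cross u v.
Proof. by apply/rowP => i; rewrite !mxE; ring. Qed.

Lemma dot_cross u v :
  dot (cross u v) (cross u v) = dot u u * dot v v - dot u v ^+ 2.
Proof.
by have [c0 c1 c2] := crossE u v; rewrite !dotE c0 c1 c2; ring.
Qed.

(** The reflection in the plane through the origin orthogonal to [x]. *)
Definition reflection x v := v - (2 * dot x v / dot x x) *: x.

Lemma dot_reflection x u v : x != 0 ->
  dot (reflection x u) (reflection x v) = dot u v.
Proof.
rewrite -dot_eq0 => xx0.
by rewrite /reflection !(dotBl, dotZl, dotBr, dotZr) [dot u x]dotC; field.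
Qed.

(** The sign is the determinant of the reflection: an isometry of determinant
-1 reverses the orientation that defines the cross product. *)
Lemma cross_reflection x u v : x != 0 ->
  cross (reflection x u) (reflection x v) = - reflection x (cross u v).
Proof.
rewrite -dot_eq0 => xx0.
have [c0 c1 c2] := crossE u v.
have [d0 d1 d2] := crossE (reflection x u) (reflection x v).
have E w i : reflection x w 0 i = w 0 i - 2 * dot x w / dot x x * x 0 i.
  by rewrite !mxE.
have NE w i : (- w) 0 i = - w 0 i by rewrite mxE.
apply: row3P; rewrite ?(d0, d1, d2) NE !E ?(c0, c1, c2).
all: rewrite !(dotE x (cross _ _)) c0 c1 c2.
all: by move: xx0; rewrite !dotE => xx0; field.
Qed.
End Euclidean.

(** * Gauss curvature from the unnormalised normal *)

Section GaussCurvature.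
Variable R : realType.
Implicit Types (X : R -> R -> 'rV[R]_3) (s u : R).

(** Replacing the unit normal by the cross product [n] of the partial
derivatives removes the square root: the numerator acquires the factor
[<n,n>], which by Lagrange's identity is the determinant of the first
fundamental form. *)
Lemma gauss_curvatureE X s u :
  let n := cross (pderiv1 X s u) (pderiv2 X s u) in
  gauss_curvature X s u =
    (dot (pderiv1 (pderiv1 X) s u) n * dot (pderiv2 (pderiv2 X) s u) n -
     dot (pderiv2 (pderiv1 X) s u) n ^+ 2) / dot n n ^+ 2.
Proof.
rewrite /gauss_curvature /unit_normal /=.
move: (pderiv1 (pderiv1 X) s u) (pderiv2 (pderiv1 X) s u)
  (pderiv2 (pderiv2 X) s u) (pderiv1 X s u) (pderiv2 X s u) => l m p v w.
rewrite !dotZr -dot_cross -enorm_sqr.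
(* At a singular point both sides are 0, since the inverse of 0 is 0. *)
have [-> | n0] := eqVneq (enorm (cross v w)) 0; last by field.
by rewrite !(expr0n, invr0, mulr0, mul0r, subr0) /= ?(expr0n, invr0, mulr0).
Qed.
End GaussCurvature.

(** * Derivatives of vector-valued functions *)

Section VectorCalculus.
Variable R : realType.
Implicit Types (t : R) (f g : R -> 'rV[R]_3) (v w c : 'rV[R]_3).

Lemma is_derive_derive1 t f v : is_derive t 1 f v -> derive1 f t = v.
Proof. by move=> df; rewrite derive1E derive_val. Qed.

Lemma is_derive_rowP t f v :
  is_derive t 1 f v <-> forall i, is_derive t 1 (fun t' => f t' 0 i) (v 0 i).
Proof.
split=> [[df <-] i|df].
  apply: DeriveDef; first exact: (derivable_mxP _ _ _).1.
  by rewrite derive_mx ?mxE.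
have der : derivable f t 1.
  by apply/derivable_mxP => i j; rewrite ord1; case: (df j).
apply: DeriveDef => //; rewrite derive_mx //; apply/rowP => i; rewrite mxE.
exact: derive_val.
Qed.

Lemma is_derive_dot t f g v w :
  is_derive t 1 f v -> is_derive t 1 g w ->
  is_derive t 1 (fun t' => dot (f t') (g t')) (dot v (g t) + dot (f t) w).
Proof.
move=> /is_derive_rowP df /is_derive_rowP dg.
pose F i := fun t' => f t' 0 i; pose G i := fun t' => g t' 0 i.
have -> : (fun t' => dot (f t') (g t')) =
    F 0 * G 0 + F 1 * G 1 + F 2%:R * G 2%:R.
  by apply/funext => t'; rewrite dotE.
have dFG i := is_deriveM (df i) (dg i).
apply: (is_derive_eq (is_deriveD (is_deriveD (dFG 0) (dFG 1)) (dFG 2%:R))).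
rewrite !dotE /F /G /GRing.scale /=; ring.
Qed.

Lemma is_derive_scale t (k : R -> R) f (dk : R) v :
  is_derive t 1 k dk -> is_derive t 1 f v ->
  is_derive t 1 (fun t' => k t' *: f t') (dk *: f t + k t *: v).
Proof.
move=> dk' /is_derive_rowP df; apply/is_derive_rowP => i.
have -> : (fun t' => (k t' *: f t') 0 i) = k * (fun t' => f t' 0 i).
  by apply/funext => t'; rewrite mxE.
apply: (is_derive_eq (is_deriveM dk' (df i))).
rewrite !mxE /GRing.scale /=; ring.
Qed.

Lemma is_derive_invdot t f v (r : R) : f t != 0 -> is_derive t 1 f v ->
  is_derive t 1 (fun t' => r ^+ 2 / dot (f t') (f t'))
    (- (r ^+ 2 / dot (f t) (f t)) * (2 * dot (f t) v / dot (f t) (f t))).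
Proof.
rewrite -dot_eq0 => ff0 df.
have dff := is_derive_dot df df.
have dV := is_deriveZ (r ^+ 2) (is_deriveV ff0 dff).
apply: (is_derive_eq dV).
rewrite /GRing.scale /= dotC; by field.
Qed.

Lemma is_derive_subc t f v c :
  is_derive t 1 f v -> is_derive t 1 (fun t' => f t' - c) v.
Proof.
move=> df; apply: (is_derive_eq (is_deriveB df (is_derive_cst c t 1))).
exact: subr0.
Qed.

Lemma is_derive_near_neq t f v c : is_derive t 1 f v -> f t != c ->
  \forall t' \near t, f t' != c.
Proof.
move=> /is_derive_subc - /(_ c) [/derivable1_diffP dfc _].
rewrite -subr_eq0 => /(cvgr_neq0 _ (differentiable_continuous dfc)).
by apply: filterS => t'; rewrite subr_eq0.
Qed.
End VectorCalculus.

(** * First and second derivatives of the inversion *)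

Section Inversion.
Variable R : realType.
Implicit Types (r t : R) (f g : R -> 'rV[R]_3) (v w z x c : 'rV[R]_3).

(** The differential of the inversion at the point [c + x], applied to [v]. *)
Definition dinversion r x v := (r ^+ 2 / dot x x) *: reflection x v.

(** The mixed second derivative of the inversion along a family of points with
offset [x] from the centre, first derivatives [v] and [w], and mixed second
derivative [z].  Factoring the reflection out of the whole expression makes the
pairing with the reflected normal in [dot_d2inversion] immediate. *)
Definition d2inversion r x v w z :=
  (r ^+ 2 / dot x x) *: reflection x (z - (2 * dot x v / dot x x) *: w
    - (2 * dot x w / dot x x) *: v + (2 * dot v w / dot x x) *: x).

(** The left-hand side is the derivative of [dinversion r x w] as the product
rule delivers it, [v] being the derivative of [x] and [z] that of [w]. *)
Lemma d2inversionE r x v w z : x != 0 ->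
  (- (r ^+ 2 / dot x x) * (2 * dot x v / dot x x)) *: reflection x w +
  (r ^+ 2 / dot x x) *: (z -
    ((2 * dot x w * (- (1 ^+ 2 / dot x x) * (2 * dot x v / dot x x)) +
      1 ^+ 2 / dot x x * (2 * (dot v w + dot x z))) *: x +
     (2 * dot x w / dot x x) *: v)) = d2inversion r x v w z.
Proof.
rewrite -dot_eq0 /d2inversion /reflection !(dotDr, dotNr, dotZr) => xx0.
move: (dot x x) (dot x v) (dot x w) (dot x z) (dot v w) xx0.
move=> xx xv xw xz vw xx0.
by apply/rowP => i; rewrite !mxE; field.
Qed.

Lemma is_derive_inversion r c t f v : f t != c -> is_derive t 1 f v ->
  is_derive t 1 (fun t' => inversion c r (f t')) (dinversion r (f t - c) v).
Proof.
rewrite -subr_eq0 => x0 /is_derive_subc - /(_ c) dx.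
have dinv := is_derive_scale (is_derive_invdot r x0 dx) dx.
have -> : (fun t' => inversion c r (f t')) =
    cst c + (fun t' => (r ^+ 2 / dot (f t' - c) (f t' - c)) *: (f t' - c)).
  by apply/funext => t'; rewrite /inversion enorm_sqr.
apply: (is_derive_eq (is_deriveD (is_derive_cst c t 1) dinv)).
by rewrite add0r; apply/rowP => i; rewrite !mxE; ring.
Qed.

Lemma is_derive_dinversion r c t f g v z :
  f t != c -> is_derive t 1 f v -> is_derive t 1 g z ->
  is_derive t 1 (fun t' => dinversion r (f t' - c) (g t'))
    (d2inversion r (f t - c) v (g t) z).
Proof.
rewrite -subr_eq0 => x0 /is_derive_subc - /(_ c) dx dg.
have dk := is_derive_invdot r x0 dx.
have dxg := is_derive_dot dx dg.
have dm := is_deriveM (is_deriveZ 2 dxg) (is_derive_invdot 1 x0 dx).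
have coefE : (2 \*: (fun t' => dot (f t' - c) (g t'))) *
      (fun t' => 1 ^+ 2 / dot (f t' - c) (f t' - c)) =
    (fun t' => 2 * dot (f t' - c) (g t') / dot (f t' - c) (f t' - c)).
  apply/funext => t'; rewrite -[LHS]/(2 * dot _ _ * (1 ^+ 2 / dot _ _)).
  by rewrite expr1n mul1r.
rewrite coefE in dm.
apply: (is_derive_eq
  (is_derive_scale dk (is_deriveB dg (is_derive_scale dm dx)))).
exact: d2inversionE.
Qed.
End Inversion.

(** * The Gauss curvature of an inverse surface *)

Section InverseForms.
Variable R : realType.
Implicit Types (r : R) (a b v w z x : 'rV[R]_3).

Lemma cross_dinversion r x a b : x != 0 ->
  cross (dinversion r x a) (dinversion r x b) =
  - (r ^+ 2 / dot x x) ^+ 2 *: reflection x (cross a b).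
Proof.
by move=> x0; rewrite /dinversion crossZ cross_reflection // scalerN scaleNr.
Qed.

Lemma dot_cross_dinversion r x a b : x != 0 ->
  let n := cross (dinversion r x a) (dinversion r x b) in
  dot n n = (r ^+ 2 / dot x x) ^+ 4 * dot (cross a b) (cross a b).
Proof.
by move=> x0 /=; rewrite cross_dinversion// dotZl dotZr dot_reflection//; ring.
Qed.

(** Reflections are isometries, so both of them cancel in the pairing.  The
terms of [d2inversion] along [v] and [w] disappear because these vectors are
tangent, and the term along [x] leaves the multiple of the first fundamental
form by which the second one changes. *)
Lemma dot_d2inversion r x a b v w z : x != 0 ->
  dot v (cross a b) = 0 -> dot w (cross a b) = 0 ->
  dot (d2inversion r x v w z) (cross (dinversion r x a) (dinversion r x b)) =
  - (r ^+ 2 / dot x x) ^+ 3 *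
    (dot z (cross a b) + 2 * dot v w * (dot x (cross a b) / dot x x)).
Proof.
move=> x0 v0 w0; rewrite cross_dinversion // dotZl dotZr dot_reflection //.
by rewrite !(dotDl, dotNl, dotZl) v0 w0; ring.
Qed.
End InverseForms.

Section InverseSurface.
Variable R : realType.
Implicit Types (r s u : R) (c : 'rV[R]_3).

(** The number [2 h] is the multiple of the first fundamental form that the
inversion adds to the second one; the first is only rescaled, by
[(r^2 / |x|^2)^2], because the inversion is conformal. *)
Lemma gauss_curvature_inverse_surface r c (X Xs Xu : R -> R -> 'rV[R]_3)
    (Xss Xsu Xuu : 'rV[R]_3) s u :
  X s u != c ->
  (\forall s' \near s, is_derive (s' : R) 1 (X^~ u) (Xs s' u)) ->
  (\forall u' \near u, is_derive s 1 (X^~ u') (Xs s u')) ->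
  (\forall u' \near u, is_derive (u' : R) 1 (X s) (Xu s u')) ->
  is_derive s 1 (Xs^~ u) Xss -> is_derive u 1 (Xs s) Xsu ->
  is_derive u 1 (Xu s) Xuu ->
  let x := X s u - c in
  let n := cross (Xs s u) (Xu s u) in
  let h := dot x n / dot x x in
  0 < r ->
  gauss_curvature (inverse_surface c r X) s u =
    ((dot Xss n + 2 * dot (Xs s u) (Xs s u) * h) *
     (dot Xuu n + 2 * dot (Xu s u) (Xu s u) * h) -
     (dot Xsu n + 2 * dot (Xs s u) (Xu s u) * h) ^+ 2) /
    ((r ^+ 2 / dot x x) ^+ 2 * dot n n ^+ 2).
Proof.
move=> Xc dXs dXs' dXu dXss dXsu dXuu x n h r_gt0.
have x0 : x != 0 by rewrite subr_eq0.
set Y := inverse_surface c r X.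
have Xc_s : \forall s' \near s, X s' u != c.
  exact: (is_derive_near_neq (nbhs_singleton dXs)).
have Xc_u : \forall u' \near u, X s u' != c.
  exact: (is_derive_near_neq (nbhs_singleton dXu)).
have Ys : \forall s' \near s,
    dinversion r (X s' u - c) (Xs s' u) = pderiv1 Y s' u.
  by near=> s'; apply/esym/is_derive_derive1/is_derive_inversion; near: s'.
have Ys' : \forall u' \near u,
    dinversion r (X s u' - c) (Xs s u') = pderiv1 Y s u'.
  by near=> u'; apply/esym/is_derive_derive1/is_derive_inversion; near: u'.
have Yu : \forall u' \near u,
    dinversion r (X s u' - c) (Xu s u') = pderiv2 Y s u'.
  by near=> u'; apply/esym/is_derive_derive1/is_derive_inversion; near: u'.
have Yss : pderiv1 (pderiv1 Y) s u =
    d2inversion r x (Xs s u) (Xs s u) Xss.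
  apply/is_derive_derive1/(near_eq_is_derive Ys).
  exact: (is_derive_dinversion r Xc (nbhs_singleton dXs) dXss).
have Ysu : pderiv2 (pderiv1 Y) s u =
    d2inversion r x (Xu s u) (Xs s u) Xsu.
  apply/is_derive_derive1/(near_eq_is_derive Ys').
  exact: (is_derive_dinversion r Xc (nbhs_singleton dXu) dXsu).
have Yuu : pderiv2 (pderiv2 Y) s u =
    d2inversion r x (Xu s u) (Xu s u) Xuu.
  apply/is_derive_derive1/(near_eq_is_derive Yu).
  exact: (is_derive_dinversion r Xc (nbhs_singleton dXu) dXuu).
rewrite gauss_curvatureE Yss Ysu Yuu -(nbhs_singleton Ys) -(nbhs_singleton Yu).
rewrite dot_cross_dinversion // !dot_d2inversion ?cross_dotl ?cross_dotr //.
rewrite -/x -/n -/h.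
rewrite [dot (Xu s u) (Xs s u)]dotC.
have k0 : r ^+ 2 / dot x x != 0.
  by rewrite mulf_neq0 ?invr_eq0 ?dot_eq0 // expf_neq0 // gt_eqF.
have [-> | nn0] := eqVneq (dot n n) 0.
  by rewrite mulr0 !expr0n /= mulr0 !invr0 !mulr0.
move: (r ^+ 2 / dot x x) k0 => k k0.
by field; apply/andP.
Unshelve. all: by end_near.
Qed.
End InverseSurface.

(** * The tangent developable *)

Section TangentDevelopable.
Variables (R : realType) (I : set R) (gamma T N B : R -> 'rV[R]_3).
Variables (kappa tau : R -> R).
Hypothesis I_open : open I.
Hypothesis gamma_smooth : smooth_on I gamma.
Hypothesis fr : frenet_apparatus I gamma T N B kappa tau.
Implicit Types (s u r : R) (c : 'rV[R]_3).

Lemma binormal_orthonormal s : I s ->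
  [/\ dot (T s) (B s) = 0, dot (N s) (B s) = 0 & dot (B s) (B s) = 1].
Proof.
move=> Is; rewrite (frenet_binormal fr Is) dot_cross cross_dotl cross_dotr.
rewrite (frenet_orthTN fr Is) (enorm1_dot (frenet_unitT fr Is)).
by rewrite (enorm1_dot (frenet_unitN fr Is)) expr0n subr0 mulr1.
Qed.

Lemma near_I s : I s -> \forall s' \near s, I s'.
Proof. by move=> Is; apply: open_nbhs_nbhs. Qed.

Lemma gamma_derive n s : I s ->
  is_derive s 1 gamma^`(n)%classic (gamma^`(n.+1)%classic s).
Proof.
move=> Is; rewrite derive1nS derive1E.
by apply: DeriveDef => //; exact: gamma_smooth.
Qed.

Lemma tangentE s : I s -> T s = gamma^`(1)%classic s.
Proof. exact: (frenet_tangent fr). Qed.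

Lemma gamma2E s : I s -> gamma^`(2)%classic s = kappa s *: N s.
Proof.
move=> Is; rewrite derive1nS.
apply/is_derive_derive1/(near_eq_is_derive _ (frenet_T' fr Is)).
by near=> s'; apply: tangentE; near: s'; exact: near_I.
Unshelve. all: by end_near.
Qed.

(** Differentiating [<gamma'', B> = 0] yields the component of [gamma'''] along
[B] from the Frenet equation for [B], which avoids a derivative of [kappa]. *)
Lemma gamma3_binormal s : I s ->
  dot (gamma^`(3)%classic s) (B s) = kappa s * tau s.
Proof.
move=> Is; have [_ NB _] := binormal_orthonormal Is.
have d := is_derive_dot (gamma_derive 2 Is) (frenet_B' fr Is).
have d0 : is_derive s 1 (fun s' => dot (gamma^`(2)%classic s') (B s')) 0.
  apply: (near_eq_is_derive _ (is_derive_cst (0 : R) s 1)).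
  near=> s'; have Is' : I s' by near: s'; exact: near_I.
  have [_ NB' _] := binormal_orthonormal Is'.
  by rewrite gamma2E // dotZl NB' mulr0.
have := @derive_val _ _ _ _ _ _ _ d; rewrite (@derive_val _ _ _ _ _ _ _ d0).
rewrite gamma2E // dotZl dotZr (enorm1_dot (frenet_unitN fr Is)) => e; lra.
Unshelve. all: by end_near.
Qed.

(** The normal of the developable is [- u kappa B], so its second fundamental
form, taken with this normal, reduces to its entry in [s, s], which is
[- u kappa <u gamma''', B> = - u^2 kappa^2 tau].  The multiple of [I]
added to it by the inversion contributes through [E G - F^2 = u^2 kappa^2]. *)
Lemma gauss_curvature_inverse_developable r c s u :
  0 < r -> I s -> u * kappa s != 0 -> tangent_developable gamma T s u != c ->
  let x := tangent_developable gamma T s u - c in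
  gauss_curvature (inverse_surface c r (tangent_developable gamma T)) s u =
    2 * dot x (B s) * (dot x x * tau s + 2 * dot x (B s) * (u * kappa s)) /
    (r ^+ 4 * (u * kappa s)).
Proof.
move=> r_gt0 Is uk0 Mc x.
(* The partial derivative in [s], written with derivatives of [gamma] because
   these can be differentiated again. *)
pose Ms s' u' := gamma^`(1)%classic s' + u' *: gamma^`(2)%classic s'.
pose Mu (s' u' : R) := T s'.
have der_affine (a b : 'rV[R]_3) (t : R) :
    is_derive t 1 (fun t' : R => a + t' *: b) b.
  have d := is_derive_scale (is_derive_id t 1) (is_derive_cst b t 1).
  apply: (is_derive_eq (is_deriveD (is_derive_cst a t 1) d)).
  by rewrite add0r scale1r scaler0 addr0.
have dMs s' u' : I s' ->
    is_derive s' 1 (tangent_developable gamma T ^~ u') (Ms s' u').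
  move=> Is'; rewrite /Ms gamma2E //.
  exact: (is_deriveD (gamma_derive 0 Is') (is_deriveZ u' (frenet_T' fr Is'))).
have dMss :
    is_derive s 1 (Ms^~ u) (gamma^`(2)%classic s + u *: gamma^`(3)%classic s).
  exact: (is_deriveD (gamma_derive 1 Is) (is_deriveZ u (gamma_derive 2 Is))).
have [TB NB BB] := binormal_orthonormal Is.
rewrite (gauss_curvature_inverse_surface (Xs := Ms) (Xu := Mu) Mc _ _ _ dMss
  (der_affine _ _ u) (is_derive_cst _ _ _) r_gt0); last 3 first.
- by near=> s'; apply: dMs; near: s'; exact: near_I.
- by near=> u'; exact: dMs.
- by near=> u'; exact: der_affine.
have x0 : x != 0 by rewrite subr_eq0.
rewrite -/x; clearbody x.
have MsE : Ms s u = T s + (u * kappa s) *: N s.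
  by rewrite /Ms -tangentE // gamma2E // scalerA.
have nE : cross (Ms s u) (Mu s u) = - (u * kappa s) *: B s.
  rewrite MsE /Mu (frenet_binormal fr Is); apply/rowP => i; rewrite !mxE; ring.
rewrite nE MsE /Mu gamma2E //.
rewrite !(dotZl, dotZr, dotDl, dotDr) [dot (N s) (T s)]dotC.
rewrite (frenet_orthTN fr Is) NB BB gamma3_binormal //.
rewrite (enorm1_dot (frenet_unitN fr Is)) (enorm1_dot (frenet_unitT fr Is)).
have -> : dot 0 (B s) = 0 by rewrite dotE !mxE; ring.
move: x0 uk0; rewrite -dot_eq0 mulf_eq0 negb_or => xx0 /andP[u0 k0].
have r0 : r != 0 by rewrite gt_eqF.
by field; apply/and4P.
Unshelve. all: by end_near.
Qed.
End TangentDevelopable.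

(** * Flat inverse surfaces *)

Section FlatInverse.
Variables (R : realType) (I : set R) (gamma T N B : R -> 'rV[R]_3).
Variables (kappa tau : R -> R).
Hypothesis I_open : open I.
Hypothesis gamma_smooth : smooth_on I gamma.
Hypothesis fr : frenet_apparatus I gamma T N B kappa tau.
Implicit Types (s u r : R) (c : 'rV[R]_3).

Lemma tangent_developable_subE c s u :
  tangent_developable gamma T s u - c = (gamma s - c) + u *: T s.
Proof. by rewrite /tangent_developable addrAC. Qed.

Lemma dot_developable_binormal c s u : I s ->
  dot (tangent_developable gamma T s u - c) (B s) = dot (gamma s - c) (B s).
Proof.
move=> Is; have [TB _ _] := binormal_orthonormal fr Is.
by rewrite tangent_developable_subE dotDl dotZl TB mulr0 addr0.
Qed.

Lemma tangent_plane_developableP c s u : I s -> u * kappa s != 0 ->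
  tangent_plane (tangent_developable gamma T) s u c <->
  dot (tangent_developable gamma T s u - c) (B s) = 0.
Proof.
move=> Is uk0; rewrite /tangent_plane /=.
rewrite (unit_normal_tangent_developable gamma_smooth fr Is uk0).
rewrite dotZr -opprB dotNl mulrNN.
split=> [/eqP|->]; last by rewrite mulr0.
by rewrite mulf_eq0 sgr_eq0 (negPf uk0) => /eqP.
Qed.

(** The hypothesis concerns one ruling.  If [c] were off the osculating plane at
[s], then the numerator of the curvature, a polynomial in [u] whose leading
coefficient is a multiple of [tau s], would vanish at [u = 1] and [u = -1];
this forces first [tau s = 0] and then [kappa s = 0]. *)
Lemma flat_inverse_binormal r c s : 0 < r -> I s -> kappa s != 0 ->
  (forall u, u != 0 -> tangent_developable gamma T s u != c ->
    gauss_curvature (inverse_surface c r (tangent_developable gamma T)) s u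
      = 0) ->
  dot (gamma s - c) (B s) = 0.
Proof.
move=> r_gt0 Is k0 flat; apply: contrapT => /eqP d0.
pose w u := dot (tangent_developable gamma T s u - c)
                (tangent_developable gamma T s u - c).
have K0 u : u != 0 ->
    w u * tau s + 2 * dot (gamma s - c) (B s) * (u * kappa s) = 0.
  move=> u0; have uk0 : u * kappa s != 0 by rewrite mulf_neq0.
  have Mc : tangent_developable gamma T s u != c.
    apply: contra_neq d0 => Mc.
    by rewrite -(dot_developable_binormal _ u) // Mc subrr dotE !mxE; ring.
  have /eqP := flat u u0 Mc.
  rewrite (gauss_curvature_inverse_developable I_open gamma_smooth fr) //.
  rewrite dot_developable_binormal // mulf_eq0 invr_eq0 !(mulf_eq0 (r ^+ 4)).
  rewrite (negPf uk0) expf_eq0 (gt_eqF r_gt0) andbF !orbF.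
  by rewrite !mulf_eq0 (negPf d0) pnatr_eq0 /= => /eqP.
have wE u : w u = dot (gamma s - c) (gamma s - c) +
    2 * u * dot (gamma s - c) (T s) + u ^+ 2.
  rewrite /w tangent_developable_subE !(dotDl (gamma s - c)).
  rewrite !(dotDr (gamma s - c)) !(dotZl, dotZr).
  rewrite (enorm1_dot (frenet_unitT fr Is)) [dot (T s) (gamma s - c)]dotC; ring.
have := K0 1 (oner_neq0 _); have := K0 (-1).
rewrite oppr_eq0 oner_eq0 => /(_ isT); rewrite !wE.
have := dot_ge0 (gamma s - c); move: d0 k0.
move: (dot (gamma s - c) (gamma s - c)) (dot (gamma s - c) (B s))
  (dot (gamma s - c) (T s)) (kappa s) (tau s) => W d a k t d0 k0 W0 eN eP.
(* The sum of the equations at u = 1 and u = -1. *)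
have /eqP : (1 + W) * t = 0 by lra.
rewrite mulf_eq0 => /orP[/eqP|/eqP t0]; first by lra.
have /eqP : d * k = 0 by move: eP; rewrite t0; lra.
by rewrite mulf_eq0 (negPf d0) (negPf k0).
Qed.

(** The normal is orthogonal to the ruling, so a point of the ruling whose
normal line contains [c] is the orthogonal projection of [c] to the ruling. *)
Lemma normal_line_developable_inj c s u u' : I s ->
  u * kappa s != 0 -> u' * kappa s != 0 ->
  normal_line (tangent_developable gamma T) s u c ->
  normal_line (tangent_developable gamma T) s u' c -> u = u'.
Proof.
move=> Is uk0 uk0'; have [TB _ _] := binormal_orthonormal fr Is.
suff foot v : v * kappa s != 0 ->
    normal_line (tangent_developable gamma T) s v c ->
    v = - dot (gamma s - c) (T s).
  by move=> /foot -> // /foot ->.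
move=> vk0 [t].
rewrite (unit_normal_tangent_developable gamma_smooth fr Is vk0) scalerA => cE.
have : dot (tangent_developable gamma T s v - c) (T s) = 0.
  by rewrite cE opprD addNKr -scaleNr dotZl dotC TB mulr0.
rewrite tangent_developable_subE dotDl dotZl (enorm1_dot (frenet_unitT fr Is)).
by rewrite mulr1 => /eqP; rewrite addrC addr_eq0 => /eqP.
Qed.
End FlatInverse.

Theorem theorem4p3 (R : realType) (c : 'rV[R]_3) (r : R) (I : set R)
    (gamma T N B : R -> 'rV[R]_3) (kappa tau : R -> R)
    (r_gt0 : 0 < r)
    (I_open : open I) (I_itv : is_interval I)
    (gamma_smooth : smooth_on I gamma)
    (gamma_arc_length : arc_length_param I gamma)
    (frenet : frenet_apparatus I gamma T N B kappa tau) :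
  let M := tangent_developable gamma T in
  let D := developable_domain I c gamma T kappa in
  flat_on D (inverse_surface c r M) <->
  (forall s u, D (s, u) -> normal_line M s u c) \/
  (forall s u, D (s, u) -> tangent_plane M s u c).
Proof.
move=> M D; split=> [flat | [normal | tangent] s u [/= Is uk0 Mc]].
- right=> s u [/= Is uk0 _].
  apply/(tangent_plane_developableP gamma_smooth frenet) => //.
  rewrite (dot_developable_binormal frenet) //.
  have k0 : kappa s != 0 by apply: contra_neq uk0 => ->; rewrite mulr0.
  apply: (flat_inverse_binormal I_open gamma_smooth frenet r_gt0 Is k0).
  by move=> v v0 Mc; apply: flat; split => //=; rewrite mulf_neq0.
(* The parameters u and 2u would give two points of the same ruling whose
   normal lines contain c, so the domain is empty. *)
- have u2k0 : 2 * u * kappa s != 0 by rewrite -mulrA mulf_neq0.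
  have line_2u : normal_line M s (2 * u) c.
    have [M2c | M2c] := eqVneq (M s (2 * u)) c; last exact: normal.
    by exists 0; rewrite scale0r addr0.
  have line_u : normal_line M s u c by exact: normal.
  have := normal_line_developable_inj gamma_smooth frenet Is uk0 u2k0
            line_u line_2u.
  have /eqP : u != 0 by apply: contra_neq uk0 => ->; rewrite mul0r.
  by lra.
- rewrite (gauss_curvature_inverse_developable I_open gamma_smooth frenet) //.
  have -> : dot (M s u - c) (B s) = 0.
    apply/(tangent_plane_developableP gamma_smooth frenet) => //.
    exact: tangent.
  by rewrite mulr0 !mul0r.
Qed.
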